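(* For each variety $\mathbf{K}\in\Xi(\mathbf{S4})$, $$\mathsf{Log}(\sigma(\rho(\mathbf{K})))=Schem(\mathsf{Log}(\mathbf{K})^{\Box}).$$ Consequently, a logic (in the sense of axiomatic extension) $L\in\mathbf{NExt}(\mathsf{S4})$ is $\Box$-maximal if and only if it is the greatest modal companion of $\rho(L)$.
   Context: $\mathbf{S4}$ is the variety of S4-algebras: Boolean algebras with a unary $\Box$ satisfying $\Box1=1$, $\Box(a\wedge b)=\Box a\wedge\Box b$, $\Box a\le a$, $\Box a\le\Box\Box a$. In this statement $\Xi(\mathbf{S4})$ is the lattice of subvarieties of $\mathbf{S4}$. $\mathbf{NExt}(\mathsf{S4})$ is the lattice of normal axiomatic extensions of $\mathsf{S4}$ (sets of modal formulas), and $\Lambda(\mathsf{IPC})$ is the lattice of axiomatic extensions (superintuitionistic logics) of $\mathsf{IPC}$. For a class $\mathbf{K}$ of algebras, $\mathsf{Log}(\mathbf{K})$ is the set of formulas $\phi$ such that $\phi\approx1$ is valid in all members of $\mathbf{K}$. The translation $GMT$ from intuitionistic to modal formulas: $GMT(p)=\Box p$, $GMT(\top)=\top$, $GMT(\bot)=\bot$, $GMT$ commutes with $\wedge,\vee$, and $GMT(\phi\to\psi)=\Box(\neg GMT(\phi)\vee GMT(\psi))$. $M\in\mathbf{NExt}(\mathsf{S4})$ is a modal companion of $L\in\Lambda(\mathsf{IPC})$ if for all intuitionistic $\phi$: $\phi\in L\iff GMT(\phi)\in M$. For $M\in\mathbf{NExt}(\mathsf{S4})$, $\rho(M)=\{\phi:GMT(\phi)\in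 M\}\in\Lambda(\mathsf{IPC})$. For an S4-algebra $\mathcal{B}$, $\mathcal{B}_\Box=\{a\in B:a=\Box a\}$ is a Heyting algebra with the inherited $0,1,\wedge,\vee$ and implication $\Box(\neg a\vee b)$. For a variety $\mathbf{K}$ of S4-algebras, $\rho(\mathbf{K})=\{\mathcal{B}_\Box:\mathcal{B}\in\mathbf{K}\}$. For a Heyting algebra $\mathcal{H}$, $B(\mathcal{H})$ is its Boolean envelope: the Boolean algebra generated by $\mathcal{H}$, realized inside the powerset of the set of prime filters of $\mathcal{H}$ via $a\mapsto\{x:a\in x\}$, with $\Box\bigl(\bigwedge_{i=1}^n(\neg c_i\vee d_i)\bigr)=\bigwedge_{i=1}^n(c_i\to d_i)$ for $c_i,d_i\in H$, where $\to$ is Heyting implication; it is an S4-algebra. For a variety $\mathbf{P}$ of Heyting algebras, $\sigma(\mathbf{P})=\mathbb{HSP}\{B(\mathcal{H}):\mathcal{H}\in\mathbf{P}\}$. For $L\in\mathbf{NExt}(\mathsf{S4})$, its $\Box$-variant is $L^\Box=\{\phi:\phi[\Box\overline p/\overline p]\in L\}$, where $\phi[\Box\overline p/\overline p]$ substitutes $\Box q$ for each proposition letter $q$. For a $\Box$-variant $L'$, $Schem(L')=\{\phi:\forall\overline\psi,\ \phi[\overline\psi/\overline p]\in L'\}$, with $\overline\psi$ ranging over substitutions of modal formulas for proposition letters. $L$ is $\Box$-maximal if for every $S\in\mathbf{NExt}(\mathsf{S4})$, $L^\Box=S^\Box$ implies $S\subseteq L$. *)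

(* Defs.v *)
From HB Require Import structures.
From mathcomp Require Import all_boot all_order.
From mathcomp Require Import boolp classical_sets.

Set Implicit Arguments.
Unset Strict Implicit.
Unset Printing Implicit Defensive.

Import Order.Theory.
Local Open Scope classical_set_scope.
Local Open Scope order_scope.

#[key="T"]
HB.mixin Record CTBDistrLattice_isS4 d T of Order.CTBDistrLattice d T := {
  s4box : T -> T;
  s4box1 : s4box \top = \top;
  s4boxI : forall a b : T, s4box (a `&` b) = s4box a `&` s4box b;
  s4box_le : forall a : T, s4box a <= a;
  s4box_le2 : forall a : T, s4box a <= s4box (s4box a)
}.

#[short(type="s4Type")]
HB.structure Definition S4Algebra d :=
  { T of Order.CTBDistrLattice d T & CTBDistrLattice_isS4 d T }.

#[key="T"]
HB.mixin Record TBDistrLattice_isHeyting d T of Order.TBDistrLattice d T := {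
  himp : T -> T -> T;
  himpP : forall a b c : T, (c `&` a <= b) = (c <= himp a b)
}.

#[short(type="heytingType")]
HB.structure Definition Heyting d :=
  { T of Order.TBDistrLattice d T & TBDistrLattice_isHeyting d T }.

Definition s4_hom d (A B : s4Type d) (f : A -> B) : Prop :=
  [/\ f \bot = \bot, f \top = \top &
      [/\ forall a b, f (a `&` b) = f a `&` f b,
          forall a b, f (a `|` b) = f a `|` f b,
          forall a, f (~` a) = ~` f a &
          forall a, f (s4box a) = s4box (f a)]].

Definition heyting_hom d (G H : heytingType d) (f : G -> H) : Prop :=
  [/\ f \bot = \bot, f \top = \top &
      [/\ forall a b, f (a `&` b) = f a `&` f b,
          forall a b, f (a `|` b) = f a `|` f b &
          forall a b, f (himp a b) = himp (f a) (f b)]].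

Section Product.
Variables (d : Order.disp_t) (I : Type) (B : I -> s4Type d).

Definition s4_prod := forall i, B i.

HB.instance Definition _ := Choice.on s4_prod.

Implicit Types x y z : s4_prod.

Let ext x y : (forall i, x i = y i) -> x = y.
Proof. exact: functional_extensionality_dep. Qed.

Let le x y : bool := `[< forall i, x i <= y i >].
Let lt x y : bool := (y != x) && le x y.
Let meet x y : s4_prod := fun i => x i `&` y i.
Let join x y : s4_prod := fun i => x i `|` y i.

Let le_def x y : le x y = (meet x y == x).
Proof.
apply/asboolP/eqP => [xy|xy i].
  by apply: ext => i; exact: (elimT meet_idPl (xy i)).
by rewrite leEmeet -{2}xy.
Qed.

Let lt_def x y : lt x y = (y != x) && le x y. Proof. by []. Qed.
Let meetC : commutative meet.
Proof. by move=> x y; apply: ext => i; apply: meetC. Qed.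
Let joinC : commutative join.
Proof. by move=> x y; apply: ext => i; apply: joinC. Qed.
Let meetA : associative meet.
Proof. by move=> x y z; apply: ext => i; apply: meetA. Qed.
Let joinA : associative join.
Proof. by move=> x y z; apply: ext => i; apply: joinA. Qed.
Let joinKI y x : meet x (join x y) = x.
Proof. by apply: ext => i; apply: joinKI. Qed.
Let meetKU y x : join x (meet x y) = x.
Proof. by apply: ext => i; apply: meetKU. Qed.
Let meetUl : left_distributive meet join.
Proof. by move=> x y z; apply: ext => i; apply: meetUl. Qed.
Let meetxx : idempotent_op meet.
Proof. by move=> x; apply: ext => i; apply: meetxx. Qed.

HB.instance Definition _ := Order.isMeetJoinDistrLattice.Build d s4_prod
  le_def lt_def meetC joinC meetA joinA joinKI meetKU meetUl meetxx.

Let bot : s4_prod := fun=> \bot.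
Let top : s4_prod := fun=> \top.
Let le0x x : bot <= x. Proof. by apply/asboolP => i; apply: le0x. Qed.
Let lex1 x : x <= top. Proof. by apply/asboolP => i; apply: lex1. Qed.

HB.instance Definition _ := Order.hasBottom.Build d s4_prod le0x.
HB.instance Definition _ := Order.hasTop.Build d s4_prod lex1.

Let compl x : s4_prod := fun i => ~` x i.
Let joinxC x : x `|` compl x = \top.
Proof. by apply: ext => i; apply: joinxC. Qed.
Let meetxC x : x `&` compl x = \bot.
Proof. by apply: ext => i; apply: meetxC. Qed.

HB.instance Definition _ :=
  Order.TBDistrLattice_hasComplement.Build d s4_prod joinxC meetxC.

Let box x : s4_prod := fun i => s4box (x i).
Let box1 : box \top = \top.
Proof. by apply: ext => i; apply: s4box1. Qed.
Let boxI x y : box (x `&` y) = box x `&` box y.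
Proof. by apply: ext => i; apply: s4boxI. Qed.
Let box_le x : box x <= x.
Proof. by apply/asboolP => i; apply: s4box_le. Qed.
Let box_le2 x : box x <= box (box x).
Proof. by apply/asboolP => i; apply: s4box_le2. Qed.

HB.instance Definition _ :=
  CTBDistrLattice_isS4.Build d s4_prod box1 boxI box_le box_le2.

End Product.

(* Classes of algebras are plain predicates: [set] is universe monomorphic, so
   using [set (s4Type d)] here would rule out S4-algebras of sets. *)
Definition s4_class d := s4Type d -> Prop.
Definition heyting_class d := heytingType d -> Prop.

Section Classes.
Variable d : Order.disp_t.
Implicit Types K : s4_class d.

Definition class_H K : s4_class d := fun A =>
  exists2 B, K B & exists2 f : B -> A, s4_hom f & forall a, exists b, f b = a.

(* Subalgebras are taken up to isomorphism, i.e. as embeddings. *)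
Definition class_S K : s4_class d := fun A =>
  exists2 B, K B & exists2 f : A -> B, s4_hom f & injective f.

(* The index type may be empty: varieties contain the trivial algebras. *)
Definition class_P K : s4_class d := fun A =>
  exists (I : Type) (B : I -> s4Type d),
    (forall i, K (B i)) /\
    exists2 f : A -> s4_prod B, s4_hom f & bijective f.

Definition class_HSP K : s4_class d := class_H (class_S (class_P K)).

Definition s4_variety K : Prop :=
  [/\ forall A, class_H K A -> K A,
      forall A, class_S K A -> K A &
      forall A, class_P K A -> K A].

End Classes.

Section Opens.
Variables (d : Order.disp_t) (B : s4Type d).

Record opens := Open { open_val : B; open_valP : open_val == s4box open_val }.

HB.instance Definition _ := [isSub for open_val].
HB.instance Definition _ := [Choice of opens by <:].

Implicit Types a b : B.
Implicit Types x y z : opens.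

Lemma s4box_idem a : s4box (s4box a) = s4box a.
Proof. by apply/eqP; rewrite eq_le s4box_le s4box_le2. Qed.

Lemma s4box_mono a b : a <= b -> s4box a <= s4box b.
Proof. by rewrite !leEmeet -s4boxI => /eqP ->. Qed.

Let openE x : s4box (val x) = val x. Proof. by rewrite -(eqP (valP x)). Qed.

Let open_meet x y : val x `&` val y == s4box (val x `&` val y).
Proof. by rewrite s4boxI !openE. Qed.
Let open_join x y : val x `|` val y == s4box (val x `|` val y).
Proof.
rewrite eq_le s4box_le andbT leUx.
have box_ub z a : val z <= a -> val z <= s4box a.
  by move=> /s4box_mono; rewrite openE.
by rewrite !box_ub ?leUl ?leUr.
Qed.
Let open_bot : \bot == s4box (\bot : B).
Proof. by rewrite eq_le s4box_le le0x. Qed.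
Let open_top : \top == s4box (\top : B).
Proof. by rewrite s4box1. Qed.
Let open_box a : s4box a == s4box (s4box a).
Proof. by rewrite s4box_idem. Qed.

Let le x y : bool := val x <= val y.
Let lt x y : bool := (y != x) && le x y.
Let meet x y : opens := Open (open_meet x y).
Let join x y : opens := Open (open_join x y).

Let le_def x y : le x y = (meet x y == x).
Proof. by rewrite /le leEmeet. Qed.
Let lt_def x y : lt x y = (y != x) && le x y. Proof. by []. Qed.
Let meetC : commutative meet.
Proof. by move=> x y; apply/val_inj/meetC. Qed.
Let joinC : commutative join.
Proof. by move=> x y; apply/val_inj/joinC. Qed.
Let meetA : associative meet.
Proof. by move=> x y z; apply/val_inj/meetA. Qed.
Let joinA : associative join.
Proof. by move=> x y z; apply/val_inj/joinA. Qed.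
Let joinKI y x : meet x (join x y) = x.
Proof. exact/val_inj/joinKI. Qed.
Let meetKU y x : join x (meet x y) = x.
Proof. exact/val_inj/meetKU. Qed.
Let meetUl : left_distributive meet join.
Proof. by move=> x y z; apply/val_inj/meetUl. Qed.
Let meetxx : idempotent_op meet.
Proof. by move=> x; apply/val_inj/meetxx. Qed.

HB.instance Definition _ := Order.isMeetJoinDistrLattice.Build d opens
  le_def lt_def meetC joinC meetA joinA joinKI meetKU meetUl meetxx.

Let bot : opens := Open open_bot.
Let top : opens := Open open_top.
Let le0x x : bot <= x. Proof. exact: (@le0x _ B). Qed.
Let lex1 x : x <= top. Proof. exact: (@lex1 _ B). Qed.

HB.instance Definition _ := Order.hasBottom.Build d opens le0x.
HB.instance Definition _ := Order.hasTop.Build d opens lex1.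

Let imp x y : opens := Open (open_box (~` val x `|` val y)).

Let impP x y z : (z `&` x <= y) = (z <= imp x y).
Proof.
suff -> : (z `&` x <= y) = (val z <= ~` val x `|` val y).
  rewrite [RHS](_ : _ = (val z <= s4box (~` val x `|` val y))) //.
  apply/idP/idP => [/s4box_mono|zxy]; first by rewrite openE.
  exact: le_trans zxy (s4box_le _).
by rewrite -leBLR diffE complK.
Qed.

HB.instance Definition _ := TBDistrLattice_isHeyting.Build d opens impP.

Lemma val_himp x y : val (himp x y) = s4box (~` val x `|` val y).
Proof. by []. Qed.

End Opens.

Section PrimeFilters.
Variables (d : Order.disp_t) (H : heytingType d).
Implicit Types (a b c e : H) (F : set H).

Definition lattice_filter F : Prop :=
  [/\ F \top, forall a b, a <= b -> F a -> F b &
      forall a b, F a -> F b -> F (a `&` b)].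

Record prime_filter := PrimeFilter {
  pf_set :> set H;
  pf_filter : lattice_filter pf_set;
  pf_proper : ~ pf_set \bot;
  pf_prime : forall a b, pf_set (a `|` b) -> pf_set a \/ pf_set b
}.

Lemma prime_filter_ex F e : lattice_filter F -> ~ F e ->
  exists x : prime_filter, F `<=` x /\ ~ pf_set x e.
Proof.
move=> [F1 Fle FI] Fe.
pose P (G : set H) := lattice_filter (F `|` G)%classic /\ ~ (F `|` G)%classic e.
have [|G [[[G1 Gle GI] Ge] Gmax]] := @Zorn_bigcup H P.
  move=> C CP Ctot; split; last first.
    by case=> // -[G CG Gx]; have [_] := CP _ CG; apply; right.
  split; first by left.
    move=> a b ab [Fa|[G CG Ga]]; first by left; apply: Fle Fa.
    have [[_ Gle _] _] := CP _ CG.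
    by have [|Fb|Gb] := Gle _ _ ab; [right|left|right; exists G].
  move=> a b [Fa|[G CG Ga]] [Fb|[G' CG' Gb]].
  - by left; apply: FI.
  - have [[_ _ GI] _] := CP _ CG'.
    by have [||?|?] := GI a b; [left|right|left|right; exists G'].
  - have [[_ _ GI] _] := CP _ CG.
    by have [||?|?] := GI a b; [right|left|left|right; exists G].
  - have [GG'|G'G] := Ctot _ _ CG CG'.
      have [[_ _ GI] _] := CP _ CG'.
      by have [||?|?] := GI a b;
        [right; apply: GG'|right|left|right; exists G'].
    have [[_ _ GI] _] := CP _ CG.
    by have [||?|?] := GI a b; [right|right; apply: G'G|left|right; exists G].
set M := (F `|` G)%classic in G1 Gle GI Ge.
have ext a : ~ M a -> exists2 m, M m & m `&` a <= e.
  move=> Ma; apply: contrapT => nm.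
  pose G' := [set b | exists2 m, M m & m `&` a <= b].
  have MG' : M `<=` G' by move=> b Mb; exists b => //; apply: leIl.
  have G'a : G' a by exists \top => //; rewrite meet1x.
  have FG' : (F `|` G' = G')%classic.
    by apply/seteqP; split=> b; [case=> // Fb; apply: MG'; left|right].
  apply: (Gmax G').
    split; first by move=> b Gb; apply: MG'; right.
    by move=> /(_ _ G'a) Ga; apply: Ma; right.
  rewrite /P FG'; split=> //; split; first exact: MG' G1.
    by move=> b c bc [m Mm mb]; exists m => //; apply: le_trans bc.
  move=> b c [m Mm mb] [n Mn nc]; exists (m `&` n); first exact: GI.
  by rewrite lexI; apply/andP; split; [apply: le_trans mb|apply: le_trans nc];
    rewrite leI2 ?leIl ?leIr.
have Mprime a b : M (a `|` b) -> M a \/ M b.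
  move=> Mab; apply: contrapT => /not_orP[/ext[m Mm me] /ext[n Mn ne]].
  apply: Ge; apply: Gle (GI _ _ (GI _ _ Mm Mn) Mab).
  by rewrite meetUr leUx; apply/andP; split; [apply: le_trans me|apply: le_trans ne];
    rewrite leI2 ?leIl ?leIr.
exists (@PrimeFilter M (And3 G1 Gle GI) (fun M0 => Ge (Gle _ _ (le0x e) M0)) Mprime).
by split=> // a Fa; left.
Qed.

Definition stone a : set prime_filter := [set x | pf_set x a].

Inductive envelope : set (set prime_filter) :=
| envelope_stone a : envelope (stone a)
| envelopeI U V : envelope U -> envelope V -> envelope (U `&` V)%classic
| envelopeU U V : envelope U -> envelope V -> envelope (U `|` V)%classic
| envelopeC U : envelope U -> envelope (~` U)%classic.

(* For s = [:: (c_1, d_1); ..; (c_n, d_n)], cnf s is the element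
   (~c_1 \/ d_1) /\ .. /\ (~c_n \/ d_n) of the envelope, and cnf_imp s is
   (c_1 -> d_1) /\ .. /\ (c_n -> d_n) in H. *)
Definition cnf (s : seq (H * H)) : set prime_filter :=
  \big[setI/setT]_(cd <- s) (~` stone cd.1 `|` stone cd.2)%classic.

Definition cnf_imp (s : seq (H * H)) : H := \meet_(cd <- s) himp cd.1 cd.2.

(* Every element of the envelope has the form cnf s, and stone (cnf_imp s)
   does not depend on s: see envelope_cnf and envelope_box_cnf. *)
Definition envelope_box (U : set prime_filter) : set prime_filter :=
  [set x | exists2 s, U = cnf s & stone (cnf_imp s) x].

Implicit Types (x y : prime_filter) (U V : set prime_filter).

Lemma pf_le x a b : a <= b -> pf_set x a -> pf_set x b.
Proof. by case: x => X [? Xle ?] ? ? /=; apply: Xle. Qed.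

Lemma stoneI a b : stone (a `&` b) = (stone a `&` stone b)%classic.
Proof.
apply/seteqP; split=> [x xab|x [xa xb]].
  by split; apply: pf_le xab; rewrite ?leIl ?leIr.
by have [_ _ XI] := pf_filter x; apply: XI.
Qed.

Lemma stoneU a b : stone (a `|` b) = (stone a `|` stone b)%classic.
Proof.
apply/seteqP; split=> [x /pf_prime//|x [|]].
  by apply: pf_le; apply: leUl.
by apply: pf_le; apply: leUr.
Qed.

Lemma stone1 : stone \top = setT.
Proof. by apply/seteqP; split=> // x _; case: (pf_filter x). Qed.

Lemma stone0 : stone \bot = set0.
Proof. by apply/seteqP; split=> // x /pf_proper. Qed.

Lemma stone_himp x a b :
  stone (himp a b) x <-> forall y, x `<=` y -> (~` stone a `|` stone b)%classic y.
Proof.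
split=> [xab y xy|xab].
  have [ya|] := pselect (pf_set y a); [right|by left].
  have: stone (himp a b `&` a) y by rewrite stoneI; split=> //; apply: xy.
  by apply: pf_le; rewrite himpP.
apply: contrapT => nx; have [X1 Xle XI] := pf_filter x.
pose F := [set c | exists2 m, pf_set x m & m `&` a <= c].
have FF : lattice_filter F.
  split; first by exists \top => //; apply: lex1.
    by move=> c e ce [m xm mc]; exists m => //; apply: le_trans ce.
  move=> c e [m xm mc] [n xn ne]; exists (m `&` n); first exact: XI.
  by rewrite lexI; apply/andP; split; [apply: le_trans mc|apply: le_trans ne];
    rewrite leI2 ?leIl ?leIr.
have [|y [Fy yb]] := prime_filter_ex FF (e := b).
  by move=> [m xm]; rewrite himpP => mab; apply: nx; apply: Xle xm.
have [|ya|//] := xab y.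
  by move=> m xm; apply: Fy; exists m => //; apply: leIl.
by apply: ya; apply: Fy; exists \top => //; rewrite meet1x.
Qed.

Lemma stone_cnf_imp x s : stone (cnf_imp s) x <-> forall y, x `<=` y -> cnf s y.
Proof.
elim: s => [|[a b] s IH]; rewrite /cnf_imp /cnf ?big_nil ?big_cons ?stone1 //=.
rewrite stoneI; split=> [[/stone_himp xab /IH xs] y xy|xs].
  by split; [apply: xab|apply: xs].
by split; [apply/stone_himp => y /xs[]|apply/IH => y /xs[]].
Qed.

Lemma envelope_cnf U : envelope U -> exists s, U = cnf s.
Proof.
pose cnfs (V : set prime_filter) := exists s, V = cnf s.
have cnfI V W : cnfs V -> cnfs W -> cnfs (V `&` W)%classic.
  by move=> [s ->] [t ->]; exists (s ++ t); rewrite /cnf big_cat.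
have cnf1U a b s : cnfs ((~` stone a `|` stone b) `|` cnf s)%classic.
  elim: s => [|[a' b'] s IH].
    by exists [::]; rewrite /cnf big_nil setUT.
  rewrite /cnf big_cons setUIr; apply: cnfI => //=.
  exists [:: (a `&` a', b `|` b')]; rewrite /cnf big_cons big_nil setIT /=.
  by rewrite stoneI stoneU setCI setUACA.
have cnfU V W : cnfs V -> cnfs W -> cnfs (V `|` W)%classic.
  move=> [s ->] [t ->]; elim: s => [|[a b] s IH].
    by exists [::]; rewrite /cnf big_nil setTU.
  by rewrite {1}/cnf big_cons setUIl; apply: cnfI.
suff: envelope U -> cnfs U /\ cnfs (~` U)%classic by move=> /[apply] -[].
elim=> {U} [a|U V _ [] ? ? _ [] ? ?|U V _ [] ? ? _ [] ? ?|U _ [] ? ?].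
- split; [exists [:: (\top, a)]|exists [:: (a, \bot)]];
    rewrite /cnf big_cons big_nil setIT /=.
    by rewrite stone1 setCT set0U.
  by rewrite stone0 setU0.
- by rewrite setCI; split; [apply: cnfI|apply: cnfU].
- by rewrite setCU; split; [apply: cnfU|apply: cnfI].
- by rewrite setCK.
Qed.

Lemma envelope_boxP U x : envelope U ->
  envelope_box U x <-> forall y, x `<=` y -> U y.
Proof.
move=> /envelope_cnf[s Us]; split=> [[t -> /stone_cnf_imp//]|xU].
by exists s => //; apply/stone_cnf_imp; rewrite -Us.
Qed.

Lemma cnf_envelope s : envelope (cnf s).
Proof.
elim: s => [|[a b] s IH]; rewrite /cnf ?big_nil ?big_cons.
  by rewrite -stone1; apply: envelope_stone.
by apply: envelopeI IH; do ?apply: envelopeU;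
  do ?apply: envelopeC; apply: envelope_stone.
Qed.

Lemma envelope_box_cnf s : envelope_box (cnf s) = stone (cnf_imp s).
Proof.
apply/seteqP; split=> x.
  by move=> /(envelope_boxP _ (cnf_envelope s))/stone_cnf_imp.
by move=> /stone_cnf_imp/(envelope_boxP _ (cnf_envelope s)).
Qed.

Lemma envelope_box_closed U : envelope U -> envelope (envelope_box U).
Proof.
by move=> /envelope_cnf[s ->]; rewrite envelope_box_cnf; apply: envelope_stone.
Qed.

End PrimeFilters.

Section BooleanEnvelope.
Variables (d : Order.disp_t) (H : heytingType d).

Record bool_envelope := BoolEnvelope {
  env_val : set (prime_filter H);
  env_valP : `[< envelope env_val >]
}.

HB.instance Definition _ := [isSub for env_val].
HB.instance Definition _ := [Choice of bool_envelope by <:].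

Implicit Types U V W : bool_envelope.

Let envP U : envelope (val U). Proof. exact/asboolP/(valP U). Qed.
Let mk (X : set (prime_filter H)) (eX : envelope X) : bool_envelope :=
  BoolEnvelope (asboolT eX).

Let le U V : bool := `[< val U `<=` val V >].
Let lt U V : bool := (V != U) && le U V.
Let meet U V : bool_envelope := mk (envelopeI (envP U) (envP V)).
Let join U V : bool_envelope := mk (envelopeU (envP U) (envP V)).

Let le_def U V : le U V = (meet U V == U).
Proof.
by apply/asboolP/eqP => [/setIidPl UV|/(congr1 val)/setIidPl//]; apply/val_inj.
Qed.
Let lt_def U V : lt U V = (V != U) && le U V. Proof. by []. Qed.
Let meetC : commutative meet.
Proof. by move=> U V; apply/val_inj/setIC. Qed.
Let joinC : commutative join.
Proof. by move=> U V; apply/val_inj/setUC. Qed.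
Let meetA : associative meet.
Proof. by move=> U V W; apply/val_inj/setIA. Qed.
Let joinA : associative join.
Proof. by move=> U V W; apply/val_inj/setUA. Qed.
Let joinKI V U : meet U (join U V) = U.
Proof. by apply/val_inj; rewrite /= setUC setKU. Qed.
Let meetKU V U : join U (meet U V) = U.
Proof. by apply/val_inj; rewrite /= setIC setKI. Qed.
Let meetUl : left_distributive meet join.
Proof. by move=> U V W; apply/val_inj/setIUl. Qed.
Let meetxx : idempotent_op meet.
Proof. by move=> U; apply/val_inj/setIid. Qed.

HB.instance Definition _ := Order.isMeetJoinDistrLattice.Build d bool_envelope
  le_def lt_def meetC joinC meetA joinA joinKI meetKU meetUl meetxx.

Let env0 : envelope (set0 : set (prime_filter H)).
Proof. by rewrite -stone0; apply: envelope_stone. Qed.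
Let envT : envelope (setT : set (prime_filter H)).
Proof. by rewrite -stone1; apply: envelope_stone. Qed.
Let bot : bool_envelope := mk env0.
Let top : bool_envelope := mk envT.
Let le0x U : bot <= U. Proof. by apply/asboolP => x. Qed.
Let lex1 U : U <= top. Proof. by apply/asboolP => x. Qed.

HB.instance Definition _ := Order.hasBottom.Build d bool_envelope le0x.
HB.instance Definition _ := Order.hasTop.Build d bool_envelope lex1.

Let compl U : bool_envelope := mk (envelopeC (envP U)).
Let joinxC U : U `|` compl U = \top.
Proof. exact/val_inj/setUv. Qed.
Let meetxC U : U `&` compl U = \bot.
Proof. exact/val_inj/setICr. Qed.

HB.instance Definition _ :=
  Order.TBDistrLattice_hasComplement.Build d bool_envelope joinxC meetxC.

Let box U : bool_envelope := mk (envelope_box_closed (envP U)).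

Let boxP U (x : prime_filter H) :
  val (box U) x <-> forall y : prime_filter H, x `<=` y -> val U y.
Proof. exact: envelope_boxP. Qed.

Let box1 : box \top = \top.
Proof. by apply/val_inj/seteqP; split=> // x _; apply/boxP. Qed.
Let boxI U V : box (U `&` V) = box U `&` box V.
Proof.
apply/val_inj/seteqP; split=> x.
  by move=> /boxP xUV; split; apply/boxP => y /xUV[].
by move=> [/boxP xU /boxP xV]; apply/boxP => y xy; split; [apply: xU|apply: xV].
Qed.
Let box_le U : box U <= U.
Proof. by apply/asboolP => x /boxP; apply. Qed.
Let box_le2 U : box U <= box (box U).
Proof.
apply/asboolP => x /boxP xU; apply/boxP => y xy; apply/boxP => z yz.
by apply: xU; apply: subset_trans yz.
Qed.

HB.instance Definition _ :=
  CTBDistrLattice_isS4.Build d bool_envelope box1 boxI box_le box_le2.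

Lemma val_env_box U s :
  val U = cnf s -> val (s4box U) = stone (cnf_imp s).
Proof. by move=> Us; rewrite -envelope_box_cnf -Us. Qed.

End BooleanEnvelope.

(* Heyting algebras isomorphic to some opens B, so that the class is closed
   under isomorphism. *)
Definition rho_class d (K : s4_class d) : heyting_class d := fun H =>
  exists2 B, K B & exists2 f : opens B -> H, heyting_hom f & bijective f.

Definition sigma_class d (P : heyting_class d) : s4_class d :=
  class_HSP (fun A => exists2 H, P H & A = bool_envelope H).

Inductive mform : Type :=
| MVar of nat
| MTop
| MBot
| MAnd of mform & mform
| MOr of mform & mform
| MNeg of mform
| MBox of mform.

Definition MImp (phi psi : mform) : mform := MOr (MNeg phi) psi.

Inductive iform : Type :=
| IVar of nat
| ITop
| IBot
| IAnd of iform & iform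
| IOr of iform & iform
| IImp of iform & iform.

Fixpoint msubst (s : nat -> mform) (phi : mform) : mform :=
  match phi with
  | MVar n => s n
  | MTop => MTop
  | MBot => MBot
  | MAnd a b => MAnd (msubst s a) (msubst s b)
  | MOr a b => MOr (msubst s a) (msubst s b)
  | MNeg a => MNeg (msubst s a)
  | MBox a => MBox (msubst s a)
  end.

Fixpoint isubst (s : nat -> iform) (phi : iform) : iform :=
  match phi with
  | IVar n => s n
  | ITop => ITop
  | IBot => IBot
  | IAnd a b => IAnd (isubst s a) (isubst s b)
  | IOr a b => IOr (isubst s a) (isubst s b)
  | IImp a b => IImp (isubst s a) (isubst s b)
  end.

Fixpoint GMT (phi : iform) : mform :=
  match phi with
  | IVar n => MBox (MVar n)
  | ITop => MTop
  | IBot => MBot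
  | IAnd a b => MAnd (GMT a) (GMT b)
  | IOr a b => MOr (GMT a) (GMT b)
  | IImp a b => MBox (MOr (MNeg (GMT a)) (GMT b))
  end.

Fixpoint meval d (A : s4Type d) (v : nat -> A) (phi : mform) : A :=
  match phi with
  | MVar n => v n
  | MTop => \top
  | MBot => \bot
  | MAnd a b => meval v a `&` meval v b
  | MOr a b => meval v a `|` meval v b
  | MNeg a => ~` meval v a
  | MBox a => s4box (meval v a)
  end.

Definition Log d (K : s4_class d) : set mform :=
  [set phi | forall A, K A -> forall v : nat -> A, meval v phi = \top].

(* Truth value of a modal formula when its letters and its subformulas of the
   form MBox psi that are not in the scope of another box are treated as atoms;
   a tautology is thus a substitution instance of a classical tautology. *)
Fixpoint beval (v : mform -> bool) (phi : mform) : bool :=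
  match phi with
  | MVar _ | MBox _ => v phi
  | MTop => true
  | MBot => false
  | MAnd a b => beval v a && beval v b
  | MOr a b => beval v a || beval v b
  | MNeg a => ~~ beval v a
  end.

Definition tautology (phi : mform) : Prop := forall v, beval v phi.

Record NExt_S4 (L : set mform) : Prop := {
  S4_taut : forall phi, tautology phi -> L phi;
  S4_K : forall phi psi,
    L (MImp (MBox (MImp phi psi)) (MImp (MBox phi) (MBox psi)));
  S4_T : forall phi, L (MImp (MBox phi) phi);
  S4_4 : forall phi, L (MImp (MBox phi) (MBox (MBox phi)));
  S4_mp : forall phi psi, L (MImp phi psi) -> L phi -> L psi;
  S4_nec : forall phi, L phi -> L (MBox phi);
  S4_subst : forall s phi, L phi -> L (msubst s phi)
}.

Record Ext_IPC (L : set iform) : Prop := {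
  IPC_k : forall a b, L (IImp a (IImp b a));
  IPC_s : forall a b c,
    L (IImp (IImp a (IImp b c)) (IImp (IImp a b) (IImp a c)));
  IPC_andl : forall a b, L (IImp (IAnd a b) a);
  IPC_andr : forall a b, L (IImp (IAnd a b) b);
  IPC_and : forall a b, L (IImp a (IImp b (IAnd a b)));
  IPC_orl : forall a b, L (IImp a (IOr a b));
  IPC_orr : forall a b, L (IImp b (IOr a b));
  IPC_or : forall a b c,
    L (IImp (IImp a c) (IImp (IImp b c) (IImp (IOr a b) c)));
  IPC_bot : forall a, L (IImp IBot a);
  IPC_top : L ITop;
  IPC_mp : forall a b, L (IImp a b) -> L a -> L b;
  IPC_subst : forall s a, L a -> L (isubst s a)
}.

Definition rho (M : set mform) : set iform := [set phi | M (GMT phi)].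

Definition modal_companion (M : set mform) (L : set iform) : Prop :=
  [/\ NExt_S4 M, Ext_IPC L & forall phi, L phi <-> M (GMT phi)].

Definition greatest_modal_companion (M : set mform) (L : set iform) : Prop :=
  modal_companion M L /\ forall M', modal_companion M' L -> M' `<=` M.

Definition box_variant (L : set mform) : set mform :=
  [set phi | L (msubst (fun n => MBox (MVar n)) phi)].

Definition Schem (L : set mform) : set mform :=
  [set phi | forall s : nat -> mform, L (msubst s phi)].

Definition box_maximal (L : set mform) : Prop :=
  forall S, NExt_S4 S -> box_variant L = box_variant S -> S `<=` L.

(* Main.v *)
Require Import Defs.
From HB Require Import structures.
From mathcomp Require Import all_boot all_order.
From mathcomp Require Import boolp classical_sets.

Set Implicit Arguments.
Unset Strict Implicit.
Unset Printing Implicit Defensive.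

Import Order.Theory.
Local Open Scope classical_set_scope.
Local Open Scope order_scope.

(** Let [H] be the Heyting algebra of open elements of an S4-algebra [B]. The
    subalgebra of [B] generated by its open elements consists of their Boolean
    combinations: it is closed under the box, because the box of a conjunction
    of elements [~ c \/ d], with [c] and [d] open, is the open element given by
    the conjunction of the Heyting implications [c -> d]. It is a copy of the
    Boolean envelope of [H]. The correspondence used here goes through prime
    filters: every prime filter of [H] is the trace of an ultrafilter of [B]
    ([trace_surj]) and the ultrafilters of [B] separate its elements
    ([ultrafilter_sep]), so matching elements of the envelope, which are sets of
    prime filters of [H], with elements of [B] is one-to-one in both directions
    ([represents], [represents_meval]).

    A formula lies in Schem of the box variant of Log K when all the formulas
    obtained by substituting for its letters modal formulas in boxed letters are
    valid in K. This amounts to validity in every [B] of K under valuations in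
    Boolean combinations of open elements, thus to validity in the Boolean
    envelopes of the algebras of rho K. Since HSP preserves validity
    ([Log_HSP]), that is validity in sigma (rho K), which is the first claim
    ([Log_sigma_rho]).

    For the second claim, the normal form above is carried out inside S4: a
    formula with boxed letters is S4-equivalent to a conjunction of clauses
    [~ GMT c \/ GMT d], and its box to the translation of the conjunction of the
    formulas [c -> d] ([box_variantE]). Conversely, every translation has boxed
    letters. Hence two normal extensions of S4 have the same box variant if and
    only if they have the same image under rho ([box_variant_rho]), and being
    box-maximal is the same as being the greatest modal companion. *)

(** * Evaluation of modal formulas *)

Section Evaluation.
Variable d : Order.disp_t.
Implicit Types (A B : s4Type d) (K : s4_class d).

Lemma meval_ext A (v w : nat -> A) phi :
  v =1 w -> meval v phi = meval w phi.
Proof. by move=> /funext ->. Qed.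

Lemma meval_msubst A (v : nat -> A) s phi :
  meval v (msubst s phi) = meval (fun n => meval v (s n)) phi.
Proof.
by elim: phi => //= [a -> b ->|a -> b ->|a ->|a ->].
Qed.

Lemma meval_hom A B (f : A -> B) (v : nat -> A) phi :
  s4_hom f -> f (meval v phi) = meval (f \o v) phi.
Proof.
move=> [f0 f1 [fI fU fC fB]].
by elim: phi => //= [a <- b <-|a <- b <-|a <-|a <-].
Qed.

Lemma s4_hom_id A : s4_hom (@id A). Proof. by split. Qed.

Lemma s4_hom_proj (I : Type) (B : I -> s4Type d) i :
  s4_hom (fun x : s4_prod B => x i).
Proof. by split. Qed.

Lemma class_HSP_sub K A : K A -> class_HSP K A.
Proof.
move=> KA; exists A; last by exists id; [exact: s4_hom_id|move=> a; exists a].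
exists A; last by exists id; [exact: s4_hom_id|].
exists unit, (fun=> A); split=> //; exists (fun a _ => a); first by split.
by exists (fun x => x tt) => // x; apply: funext => -[].
Qed.

Lemma Log_HSP K : Log (class_HSP K) = Log K.
Proof.
apply/seteqP; split=> phi valid A; first by move=> /class_HSP_sub /valid.
have validP C : class_P K C -> forall v : nat -> C, meval v phi = \top.
  move=> [I [B [KB [f fhom [g fK _]]]]] v; apply: (can_inj fK).
  have [_ -> _] := fhom; apply: functional_extensionality_dep => i.
  rewrite meval_hom // (meval_hom _ _ (s4_hom_proj B i)).
  exact: valid.
move=> [B [C KC [g ghom ginj]] [f fhom fsurj]] v.
pose w n := projT1 (cid (fsurj (v n))).
have fw : f \o w =1 v by move=> n; rewrite /= /w; case: cid.
rewrite -(meval_ext _ fw) -meval_hom //; have [_ <- _] := fhom; congr (f _).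
apply: ginj; rewrite meval_hom //; have [_ -> _] := ghom.
exact: validP.
Qed.

End Evaluation.

(** * Boolean envelopes and the algebras they come from *)

Lemma prime_filter_ext d (H : heytingType d) (x y : prime_filter H) :
  (forall a, pf_set x a <-> pf_set y a) -> x = y.
Proof.
case: x y => [X X1 X2 X3] [Y Y1 Y2 Y3] /= XY.
have {}XY : X = Y by apply/seteqP; split=> a /XY.
by subst Y; congr PrimeFilter; apply: Prop_irrelevance.
Qed.

(** A Boolean algebra seen as a Heyting algebra; its prime filters are its
    ultrafilters. *)
Definition boolean_heyting d (B : ctbDistrLatticeType d) : Type := B.

Section BooleanHeyting.
Variables (d : Order.disp_t) (B : ctbDistrLatticeType d).

HB.instance Definition _ := Order.CTBDistrLattice.on (boolean_heyting B).

Lemma boolean_impP (a b c : boolean_heyting B) :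
  (c `&` a <= b) = (c <= ~` a `|` b).
Proof. by rewrite -leBLR diffE complK. Qed.

HB.instance Definition _ :=
  TBDistrLattice_isHeyting.Build d (boolean_heyting B) boolean_impP.

Lemma ultrafilter_sep (a b : B) :
  (forall u : prime_filter (boolean_heyting B), pf_set u a -> pf_set u b) ->
  a <= b.
Proof.
move=> ab; apply: contrapT => nab.
have [||u [au ub]] :=
    @prime_filter_ex _ (boolean_heyting B) [set c : B | a <= c] b.
- split=> [|c e ce ac|c e ac ae]; first exact: lex1.
    exact: le_trans ce.
  by rewrite /= lexI ac.
- exact: nab.
- by apply/ub/ab/au; apply: lexx.
Qed.

Lemma ultrafilterC (u : prime_filter (boolean_heyting B)) (a : B) :
  pf_set u (~` a) <-> ~ pf_set u a.
Proof.
have [u1 _ uI] := pf_filter u; split=> [ua' ua|nua].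
  by apply: (pf_proper (p := u)); rewrite -(meetxC (a : boolean_heyting B)); apply: uI.
by case: (@pf_prime _ _ u a (~` a)) => //; rewrite joinxC.
Qed.

End BooleanHeyting.

Section Envelope.
Variables (d : Order.disp_t) (B : s4Type d) (H : heytingType d) (g : H -> B).

(** [g] identifies [H] with a Heyting algebra of open elements of [B]. *)
Record open_embedding : Prop := {
  oe_inj : injective g;
  oe0 : g \bot = \bot;
  oe1 : g \top = \top;
  oeI : forall a b, g (a `&` b) = g a `&` g b;
  oeU : forall a b, g (a `|` b) = g a `|` g b;
  oe_imp : forall a b, g (himp a b) = s4box (~` g a `|` g b)
}.

Hypothesis gP : open_embedding.

Let g_le a b : (g a <= g b) = (a <= b).
Proof.
by rewrite !leEmeet -(oeI gP); apply/eqP/eqP => [/(oe_inj gP)|->].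
Qed.

Local Notation ultrafilter := (prime_filter (boolean_heyting B)).
Implicit Types (u : ultrafilter) (b : B) (U V : set (prime_filter H)).

Lemma trace_filter u : lattice_filter [set a | pf_set u (g a)].
Proof.
have [u1 ule uI] := pf_filter u; split=> [|a b|a b]; rewrite /=.
- by rewrite (oe1 gP).
- by rewrite -g_le; apply: ule.
- by rewrite (oeI gP); apply: uI.
Qed.

Lemma trace_proper u : ~ pf_set u (g \bot).
Proof. by rewrite (oe0 gP); apply: pf_proper. Qed.

Lemma trace_prime u (a b : H) :
  pf_set u (g (a `|` b)) -> pf_set u (g a) \/ pf_set u (g b).
Proof. by rewrite (oeU gP); apply: pf_prime. Qed.

(** The trace on [H] of an ultrafilter of [B]. *)
Definition trace u : prime_filter H :=
  PrimeFilter (trace_filter u) (@trace_proper u) (@trace_prime u).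

(** A prime filter [x] of [H] is the trace of any ultrafilter that contains the
    image of [x] and the complements of the images of the elements outside [x].
    The filter [F] that these elements generate is proper because [x] is prime
    and [g] reflects the order. *)
Lemma trace_surj x : exists u, trace u = x.
Proof.
have [x1 xle xI] := pf_filter x.
pose F : set (boolean_heyting B) :=
  [set b : B | exists a c, [/\ pf_set x a, ~ pf_set x c & g a <= g c `|` b]].
have [||u [Fu _]] := @prime_filter_ex _ (boolean_heyting B) F \bot.
- split.
  + exists \top, \bot; split=> //; first exact: pf_proper.
    by rewrite (oe0 gP) join0x lex1.
  + move=> b b' bb' [a [c [xa xc le_acb]]]; exists a, c; split=> //.
    by apply: le_trans le_acb _; rewrite leU2.
  + move=> b b' [a [c [xa xc le_acb]]] [a' [c' [xa' xc' le_acb']]].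
    exists (a `&` a'), (c `|` c'); split; first exact: xI.
      by move=> /pf_prime[].
    rewrite (oeI gP) (oeU gP) joinIr; apply: leI2.
      by apply: le_trans le_acb _; rewrite leU2 ?leUl.
    by apply: le_trans le_acb' _; rewrite leU2 ?leUr.
- by move=> [a [c [xa xc]]]; rewrite joinx0 g_le => /xle /(_ xa).
(* For a outside x, the complement of g a is in F, hence in u, so that g a is
   not in u. *)
exists u; apply: prime_filter_ext => a; split=> /= [ua|xa]; last first.
  apply: Fu; exists a, \bot; split=> //; first exact: pf_proper.
  by rewrite leUr.
apply: contrapT => xa; have : pf_set u (~` g a).
  by apply: Fu; exists \top, a; split=> //; rewrite joinxC lex1.
by move=> /ultrafilterC.
Qed.

(** A set [U] of prime filters of [H] represents [b] in [B] when the
    ultrafilters containing [b] are those whose trace lies in [U]. On the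
    Boolean envelope of [H] this is the graph of the embedding into [B]
    extending [g]. *)
Definition represents U b : Prop := forall u, pf_set u b <-> U (trace u).

Lemma represents_fun U b b' : represents U b -> represents U b' -> b = b'.
Proof.
by move=> Ub Ub'; apply/eqP; rewrite eq_le; apply/andP; split;
  apply: ultrafilter_sep => u; [move=> /Ub /Ub'|move=> /Ub' /Ub].
Qed.

Lemma represents_inj U V b : represents U b -> represents V b -> U = V.
Proof.
move=> Ub Vb; apply/seteqP.
by split=> x; have [u <-] := trace_surj x; [move=> /Ub /Vb|move=> /Vb /Ub].
Qed.

Lemma represents_stone a : represents (stone a) (g a).
Proof. by []. Qed.

Lemma representsT : represents setT \top.
Proof. by move=> u; split=> // _; have [] := pf_filter u. Qed.

Lemma represents0 : represents set0 \bot.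
Proof. by move=> u; split=> // /pf_proper. Qed.

Lemma representsI U V b c :
  represents U b -> represents V c -> represents (U `&` V)%classic (b `&` c).
Proof.
move=> Ub Vc u; have [_ ule uI] := pf_filter u; split=> [ubc|[/Ub ub /Vc uc]].
  by split; [apply/Ub|apply/Vc]; apply: ule ubc; [apply: leIl|apply: leIr].
exact: uI.
Qed.

Lemma representsU U V b c :
  represents U b -> represents V c -> represents (U `|` V)%classic (b `|` c).
Proof.
move=> Ub Vc u; have [_ ule uI] := pf_filter u; split.
  by move=> /pf_prime[/Ub|/Vc]; [left|right].
by move=> [/Ub|/Vc]; apply: ule; [apply: leUl|apply: leUr].
Qed.

Lemma representsC U b : represents U b -> represents (~` U)%classic (~` b).
Proof.
by move=> Ub u; split=> [/ultrafilterC ub /Ub|Uu] //; apply/ultrafilterC => /Ub.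
Qed.

(** The reason why boxes are represented: both [B] and the envelope compute the
    box of a conjunction of elements [~ c \/ d], with [c] and [d] in [H], as the
    conjunction of the Heyting implications [c -> d]. *)
Lemma represents_cnf s : exists2 b, represents (cnf s) b &
  s4box b = g (cnf_imp s).
Proof.
elim: s => [|[c e] s [b rb boxb]]; rewrite /cnf /cnf_imp ?big_nil ?big_cons.
  by exists \top; [exact: representsT|rewrite s4box1 (oe1 gP)].
exists ((~` g c `|` g e) `&` b); last first.
  by rewrite s4boxI boxb (oeI gP) (oe_imp gP).
by apply: representsI => //; apply: representsU; first apply: representsC.
Qed.

Lemma represents_box (U : bool_envelope H) b :
  represents (val U) b -> represents (val (s4box U)) (s4box b).
Proof.
have /asboolP/envelope_cnf[s Us] := valP U.
have [b' rb' boxb'] := represents_cnf s.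
rewrite (val_env_box Us) Us => rb.
by rewrite (represents_fun rb rb') boxb'.
Qed.

Definition stone_env (a : H) : bool_envelope H :=
  BoolEnvelope (asboolT (envelope_stone a)).

Lemma represents_meval (w : nat -> H) phi :
  represents (val (meval (stone_env \o w) phi)) (meval (g \o w) phi).
Proof.
elim: phi => [n|||a IHa b IHb|a IHa b IHb|a IHa|a IHa].
- exact: represents_stone.
- exact: representsT.
- exact: represents0.
- exact: representsI.
- exact: representsU.
- exact: representsC.
- exact: represents_box.
Qed.

(** A modal formula holds in the envelope at elements of [H] exactly when it
    holds in [B] at their images. *)
Lemma meval_envelope_top (w : nat -> H) phi :
  meval (stone_env \o w) phi = \top <-> meval (g \o w) phi = \top.
Proof.
have wphi := represents_meval w phi; split=> E.
  by move: wphi; rewrite E => /represents_fun; apply; apply: representsT.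
apply: val_inj; move: wphi; rewrite E => /represents_inj; apply.
exact: representsT.
Qed.

Lemma oe_open a : s4box (g a) = g a.
Proof.
have {2}-> : a = himp \top a.
  by apply: le_anti; rewrite -himpP leIl -[X in X <= _]meetx1 himpP lexx.
by rewrite (oe_imp gP) (oe1 gP) compl1 join0x.
Qed.

End Envelope.

Arguments stone_env {d H} a.

(** Every element of the Boolean envelope of [H] is a Boolean combination of
    elements of [H]. Since there are countably many letters, a single valuation
    in [H] can interpret all the letters needed to write a countable family of
    elements as modal formulas. *)
Lemma envelope_term d (H : heytingType d) (v : nat -> bool_envelope H) :
  exists (w : nat -> H) (s : nat -> mform),
    v =1 fun n => meval (stone_env \o w) (s n).
Proof.
have vcnf n : exists t, val (v n) = cnf t.
  by have /asboolP/envelope_cnf := valP (v n).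
pose t n := projT1 (cid (vcnf n)).
have vt n : val (v n) = cnf (t n) by rewrite /t; case: cid.
(* The letters coded by (n, i, true) and (n, i, false) stand for the two
   components of the i-th pair of t n. *)
pose w k : H := if unpickle k is Some (n, i, b) then
    let cd := nth (\bot, \bot) (t n) i in if b then cd.1 else cd.2
  else \bot.
exists w, (fun n => \big[MAnd/MTop]_(i < size (t n))
  MImp (MVar (pickle (n, i : nat, true))) (MVar (pickle (n, i : nat, false)))).
move=> n; apply: val_inj; rewrite vt /=.
rewrite (big_morph (fun phi => val (meval (stone_env \o w) phi))
  (op1 := setI) (id1 := setT)) //.
rewrite /cnf (big_nth (\bot, \bot)) big_mkord; apply: eq_bigr => i _.
by rewrite /= /w !pickleK.
Qed.

Lemma opens_embedding d (B : s4Type d) : open_embedding (val : opens B -> B).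
Proof. by split=> //; exact: val_inj. Qed.

Lemma rho_class_opens d (K : s4_class d) B : K B -> rho_class K (opens B).
Proof.
move=> KB; exists B => //; exists id; first by split.
by exists id.
Qed.

Lemma rho_class_embedding d (K : s4_class d) H : rho_class K H ->
  exists2 B, K B & exists g : H -> B, open_embedding g.
Proof.
move=> [B KB [f [f0 f1 [fI fU fimp]] [h fK hK]]]; exists B => //.
have [_ v0 v1 vI vU vimp] := opens_embedding B.
exists (val \o h); split=> [|||a b|a b|a b] /=.
- exact: inj_comp val_inj (can_inj hK).
- by rewrite -f0 fK.
- by rewrite -f1 fK.
- by rewrite -vI -{1}(hK a) -{1}(hK b) -fI fK.
- by rewrite -vU -{1}(hK a) -{1}(hK b) -fU fK.
- by rewrite -vimp -{1}(hK a) -{1}(hK b) -fimp fK.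
Qed.

(** Substituting boxed letters for letters evaluates them at open elements, and
    a further substitution of arbitrary formulas makes them range over the
    subalgebra generated by the open elements, which is the envelope. *)
Lemma Log_sigma_rho d (K : s4_class d) :
  Log (sigma_class (rho_class K)) = Schem (box_variant (Log K)).
Proof.
rewrite /sigma_class Log_HSP; apply/seteqP; split=> phi valid.
  move=> s B KB v; rewrite meval_msubst /=.
  pose w n : opens B :=
    Open (introT eqP (esym (s4box_idem (v n)))).
  rewrite (meval_ext _ (w := val \o w)) //.
  apply/(meval_envelope_top (opens_embedding B)); rewrite meval_msubst.
  by apply: valid; exists (opens B) => //; apply: rho_class_opens.
move=> A [H /rho_class_embedding[B KB [g gP]] ->] v.
have [w [s vws]] := envelope_term v.
rewrite (meval_ext _ vws) -meval_msubst; apply/(meval_envelope_top gP).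
have := valid s B KB (g \o w); rewrite meval_msubst => <-.
by apply: meval_ext => n /=; rewrite (oe_open gP).
Qed.

(** * The Goedel-McKinsey-Tarski translation *)

(** Proves a tautology by cases on the truth values of its atoms and of its
    opaque subformulas. *)
Ltac taut_atoms v := repeat match goal with
  | |- context [beval v ?phi] => case: (beval v phi)
  | |- context [v ?phi] => case: (v phi)
  end.
Ltac taut := let v := fresh "v" in
  move=> v; rewrite /=; taut_atoms v; by [].

Section NormalLogic.
Variable L : set mform.
Hypothesis LS4 : NExt_S4 L.
Implicit Types (a b c x : mform) (phi psi : iform).

Lemma S4_cons1 a c : tautology (MImp a c) -> L a -> L c.
Proof. by move=> /(S4_taut LS4) /(S4_mp LS4). Qed.

Lemma S4_cons2 a b c : tautology (MImp a (MImp b c)) -> L a -> L b -> L c.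
Proof. by move=> /S4_cons1 + La => /(_ La) /(S4_mp LS4). Qed.

Lemma S4_cons3 a b c x :
  tautology (MImp a (MImp b (MImp c x))) -> L a -> L b -> L c -> L x.
Proof. by move=> /S4_cons2 + La Lb => /(_ La Lb) /(S4_mp LS4). Qed.

Lemma S4_mono a b : L (MImp a b) -> L (MImp (MBox a) (MBox b)).
Proof. by move=> /(S4_nec LS4); apply: S4_mp (S4_K LS4 _ _). Qed.

Lemma S4_boxI a b :
  L (MImp (MAnd (MBox a) (MBox b)) (MBox (MAnd a b))).
Proof.
have Lab : L (MImp (MBox a) (MBox (MImp b (MAnd a b)))).
  by apply: S4_mono; apply: (S4_taut LS4); taut.
by apply: S4_cons2 Lab (S4_K LS4 b (MAnd a b)); taut.
Qed.

Lemma S4_unnec a : L (MBox a) <-> L a.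
Proof. by split; [apply: S4_mp (S4_T LS4 a)|apply: S4_nec]. Qed.

(** A formula is open in [L] if it implies its box; boxes may be introduced
    under open hypotheses. *)
Definition open_form a := L (MImp a (MBox a)).

Lemma open_box a : open_form (MBox a).
Proof. exact: S4_4 LS4 a. Qed.

Lemma open_and a b : open_form a -> open_form b -> open_form (MAnd a b).
Proof.
by move=> oa ob; apply: S4_cons3 oa ob (S4_boxI a b); taut.
Qed.

Lemma open_or a b : open_form a -> open_form b -> open_form (MOr a b).
Proof.
have La : L (MImp (MBox a) (MBox (MOr a b))).
  by apply: S4_mono; apply: (S4_taut LS4); taut.
have Lb : L (MImp (MBox b) (MBox (MOr a b))).
  by apply: S4_mono; apply: (S4_taut LS4); taut.
have Lab : L (MImp (MOr (MBox a) (MBox b)) (MBox (MOr a b))).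
  by apply: S4_cons2 La Lb; taut.
by move=> oa ob; apply: S4_cons3 oa ob Lab; taut.
Qed.

Lemma open_GMT phi : open_form (GMT phi).
Proof.
elim: phi => [n|||a oa b ob|a oa b ob|a _ b _] /=; try exact: open_box.
- have := S4_nec LS4 (S4_taut LS4 (phi := MTop) (fun=> isT)).
  by apply: S4_cons1; taut.
- by apply: (S4_taut LS4); taut.
- exact: open_and.
- exact: open_or.
Qed.

Lemma box_intro a b : open_form a -> L (MImp a b) -> L (MImp a (MBox b)).
Proof. by move=> oa /S4_mono Lab; apply: S4_cons2 oa Lab; taut. Qed.

Lemma strict_imp_intro a b c : open_form a ->
  L (MImp (MAnd a b) c) -> L (MImp a (MBox (MImp b c))).
Proof. by move=> oa abc; apply: box_intro oa _; apply: S4_cons1 abc; taut. Qed.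

Definition equiv_form a b := L (MImp a b) /\ L (MImp b a).

Lemma equiv_refl a : equiv_form a a.
Proof. by split; apply: (S4_taut LS4); taut. Qed.

Lemma equiv_sym a b : equiv_form a b -> equiv_form b a.
Proof. by case. Qed.

Lemma equiv_trans b a c :
  equiv_form a b -> equiv_form b c -> equiv_form a c.
Proof.
move=> [ab ba] [bc cb].
by split; [apply: S4_cons2 ab bc|apply: S4_cons2 cb ba]; taut.
Qed.

Lemma equiv_and a a' b b' : equiv_form a a' -> equiv_form b b' ->
  equiv_form (MAnd a b) (MAnd a' b').
Proof.
move=> [aa' a'a] [bb' b'b].
by split; [apply: S4_cons2 aa' bb'|apply: S4_cons2 a'a b'b]; taut.
Qed.

Lemma equiv_or a a' b b' : equiv_form a a' -> equiv_form b b' ->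
  equiv_form (MOr a b) (MOr a' b').
Proof.
move=> [aa' a'a] [bb' b'b].
by split; [apply: S4_cons2 aa' bb'|apply: S4_cons2 a'a b'b]; taut.
Qed.

Lemma equiv_neg a a' : equiv_form a a' -> equiv_form (MNeg a) (MNeg a').
Proof.
by move=> [aa' a'a]; split; [apply: S4_cons1 a'a|apply: S4_cons1 aa']; taut.
Qed.

Lemma equiv_box a a' : equiv_form a a' -> equiv_form (MBox a) (MBox a').
Proof. by move=> [aa' a'a]; split; apply: S4_mono. Qed.

Lemma equiv_taut a b :
  tautology (MImp a b) -> tautology (MImp b a) -> equiv_form a b.
Proof. by split; apply: S4_taut. Qed.

Lemma equiv_box_and a b :
  equiv_form (MBox (MAnd a b)) (MAnd (MBox a) (MBox b)).
Proof.
split; last exact: S4_boxI.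
have La : L (MImp (MBox (MAnd a b)) (MBox a)).
  by apply: S4_mono; apply: (S4_taut LS4); taut.
have Lb : L (MImp (MBox (MAnd a b)) (MBox b)).
  by apply: S4_mono; apply: (S4_taut LS4); taut.
by apply: S4_cons2 La Lb; taut.
Qed.

Lemma equiv_thm a b : equiv_form a b -> L a <-> L b.
Proof. by move=> [ab ba]; split; apply: S4_mp. Qed.

Lemma equiv_open a : open_form a -> equiv_form (MBox a) a.
Proof. by split=> //; apply: S4_T LS4 a. Qed.

Lemma GMT_isubst s phi :
  equiv_form (GMT (isubst s phi)) (msubst (fun n => GMT (s n)) (GMT phi)).
Proof.
elim: phi => [n|||a IHa b IHb|a IHa b IHb|a IHa b IHb] /=.
- exact/equiv_sym/equiv_open/open_GMT.
- exact: equiv_refl.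
- exact: equiv_refl.
- exact: equiv_and.
- exact: equiv_or.
- by apply: equiv_box; apply: equiv_or => //; apply: equiv_neg.
Qed.

Lemma Ext_IPC_rho : Ext_IPC (rho L).
Proof.
have T a b : L (MImp (MBox (MImp a b)) (MImp a b)) by apply: S4_T.
split; rewrite /rho /=.
- move=> a b; apply: (S4_nec LS4); apply: strict_imp_intro; first exact: open_GMT.
  by apply: (S4_taut LS4); taut.
- move=> a b c; apply: (S4_nec LS4); apply: strict_imp_intro; first exact: open_box.
  apply: strict_imp_intro; first by apply: open_and; apply: open_box.
  apply: S4_cons3 (T (GMT a) (MBox (MImp (GMT b) (GMT c))))
    (T (GMT a) (GMT b)) (T (GMT b) (GMT c)); taut.
- by move=> a b; apply: (S4_nec LS4); apply: (S4_taut LS4); taut.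
- by move=> a b; apply: (S4_nec LS4); apply: (S4_taut LS4); taut.
- move=> a b; apply: (S4_nec LS4); apply: strict_imp_intro; first exact: open_GMT.
  by apply: (S4_taut LS4); taut.
- by move=> a b; apply: (S4_nec LS4); apply: (S4_taut LS4); taut.
- by move=> a b; apply: (S4_nec LS4); apply: (S4_taut LS4); taut.
- move=> a b c; apply: (S4_nec LS4); apply: strict_imp_intro; first exact: open_box.
  apply: strict_imp_intro; first by apply: open_and; apply: open_box.
  by apply: S4_cons2 (T (GMT a) (GMT c)) (T (GMT b) (GMT c)); taut.
- by move=> a; apply: (S4_nec LS4); apply: (S4_taut LS4); taut.
- by apply: (S4_taut LS4); taut.
- by move=> a b /(S4_unnec) /(S4_mp LS4).
- by move=> s a /(S4_subst LS4 (fun n => GMT (s n))) /(equiv_thm (GMT_isubst s a)).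
Qed.

(** The conjunction of the formulas [~ GMT c \/ GMT d], and its intuitionistic
    counterpart, the conjunction of the formulas [c -> d]. *)
Definition cnf_form (s : seq (iform * iform)) : mform :=
  foldr (fun cd => MAnd (MImp (GMT cd.1) (GMT cd.2))) MTop s.

Definition imp_form (s : seq (iform * iform)) : iform :=
  foldr (fun cd => IAnd (IImp cd.1 cd.2)) ITop s.

Lemma box_cnf_form s : equiv_form (MBox (cnf_form s)) (GMT (imp_form s)).
Proof.
elim: s => [|[c e] s IH] /=; first exact: equiv_open (open_GMT ITop).
apply: equiv_trans (equiv_box_and _ _) _.
by apply: equiv_and => //; apply: equiv_refl.
Qed.

(** The formulas [L]-equivalent to a Boolean combination of translations of
    intuitionistic formulas, in conjunctive normal form. *)
Definition has_cnf a := exists s, equiv_form a (cnf_form s).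

Lemma has_cnf_equiv a b : equiv_form a b -> has_cnf b -> has_cnf a.
Proof. by move=> ab [s bs]; exists s; apply: equiv_trans bs. Qed.

Lemma has_cnf_and a b : has_cnf a -> has_cnf b -> has_cnf (MAnd a b).
Proof.
move=> [s a_s] [t b_t]; exists (s ++ t); apply: equiv_trans (equiv_and a_s b_t) _.
elim: s {a_s} => [|cd s IH] /=; first by apply: equiv_taut; taut.
apply: equiv_trans (equiv_and (equiv_refl _) IH).
by apply: equiv_taut; taut.
Qed.

Lemma has_cnf_clause phi psi : has_cnf (MImp (GMT phi) (GMT psi)).
Proof. by exists [:: (phi, psi)]; apply: equiv_taut; taut. Qed.

Lemma has_cnf_top : has_cnf MTop.
Proof. by exists [::]; apply: equiv_refl. Qed.

Lemma has_cnf_or a b : has_cnf a -> has_cnf b -> has_cnf (MOr a b).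
Proof.
have clause phi psi t :
    has_cnf (MOr (MImp (GMT phi) (GMT psi)) (cnf_form t)).
  elim: t => [|[phi' psi'] t IH] /=.
    by apply: has_cnf_equiv has_cnf_top; apply: equiv_taut; taut.
  have := has_cnf_and (has_cnf_clause (IAnd phi phi') (IOr psi psi')) IH.
  by apply: has_cnf_equiv; apply: equiv_taut; taut.
move=> [s a_s] [t b_t]; apply: has_cnf_equiv (equiv_or a_s b_t) _.
elim: s {a_s} => [|[c e] s IH] /=.
  by apply: has_cnf_equiv has_cnf_top; apply: equiv_taut; taut.
by apply: has_cnf_equiv (has_cnf_and (clause c e t) IH);
  apply: equiv_taut; taut.
Qed.

Lemma has_cnf_GMT phi : has_cnf (GMT phi).
Proof.
by apply: has_cnf_equiv (has_cnf_clause ITop phi); apply: equiv_taut; taut.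
Qed.

Lemma has_cnf_GMTN phi : has_cnf (MNeg (GMT phi)).
Proof.
by apply: has_cnf_equiv (has_cnf_clause phi IBot); apply: equiv_taut; taut.
Qed.

(** The induction treats a formula together with its negation, and boxes are
    covered because the box of a normal form is itself a translation. *)
Lemma has_cnf_box_subst a : has_cnf (msubst (fun n => MBox (MVar n)) a).
Proof.
suff: has_cnf (msubst (fun n => MBox (MVar n)) a) /\
      has_cnf (MNeg (msubst (fun n => MBox (MVar n)) a)) by case.
elim: a => [n|||a [pa na] b [pb nb]|a [pa na] b [pb nb]|a [pa na]|a [[s a_s] _]] /=.
- by split; [apply: (has_cnf_GMT (IVar n))|apply: (has_cnf_GMTN (IVar n))].
- by split; [apply: (has_cnf_GMT ITop)|apply: (has_cnf_GMTN ITop)].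
- by split; [apply: (has_cnf_GMT IBot)|apply: (has_cnf_GMTN IBot)].
- split; first exact: has_cnf_and.
  by apply: has_cnf_equiv (has_cnf_or na nb); apply: equiv_taut; taut.
- split; first exact: has_cnf_or.
  by apply: has_cnf_equiv (has_cnf_and na nb); apply: equiv_taut; taut.
- by split=> //; apply: has_cnf_equiv pa; apply: equiv_taut; taut.
- have bs := equiv_trans (equiv_box a_s) (box_cnf_form s).
  split; first by apply: has_cnf_equiv bs (has_cnf_GMT _).
  by apply: has_cnf_equiv (equiv_neg bs) (has_cnf_GMTN _).
Qed.

End NormalLogic.

(** The least normal extension of S4. *)
Definition least_S4 : set mform := [set phi | forall L, NExt_S4 L -> L phi].

Lemma NExt_least_S4 : NExt_S4 least_S4.
Proof.
split=> [a ta|a b|a|a|a b|a|s a] /=; rewrite /least_S4 /=.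
- by move=> L LS4; apply: S4_taut.
- by move=> L LS4; apply: S4_K.
- by move=> L LS4; apply: S4_T.
- by move=> L LS4; apply: S4_4.
- by move=> ab aL L LS4; apply: (S4_mp LS4 (ab L LS4)); apply: aL.
- by move=> aL L LS4; apply: (S4_nec LS4); apply: aL.
- by move=> aL L LS4; apply: S4_subst => //; apply: aL.
Qed.

(** Boxing the letters of [a] gives a formula whose box is S4-equivalent to the
    translation of some [phi]. Membership in the box variant is therefore
    decided by [rho]; the choice of [phi] does not depend on [L]. *)
Lemma box_variantE a : exists phi, forall L, NExt_S4 L ->
  box_variant L a <-> rho L phi.
Proof.
have [s [as_ sa]] := has_cnf_box_subst NExt_least_S4 a.
exists (imp_form s) => L LS4; rewrite /box_variant /rho /=.
rewrite (equiv_thm LS4 (a := msubst _ a) (b := cnf_form s)); last first.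
  by split; [apply: as_|apply: sa].
rewrite -(S4_unnec LS4 (cnf_form s)).
by apply: equiv_thm => //; apply: box_cnf_form.
Qed.

(** The translation with the boxes in front of the letters left out. *)
Fixpoint GMT_unboxed (phi : iform) : mform :=
  match phi with
  | IVar n => MVar n
  | ITop => MTop
  | IBot => MBot
  | IAnd a b => MAnd (GMT_unboxed a) (GMT_unboxed b)
  | IOr a b => MOr (GMT_unboxed a) (GMT_unboxed b)
  | IImp a b => MBox (MImp (GMT_unboxed a) (GMT_unboxed b))
  end.

Lemma GMT_unboxedE phi :
  GMT phi = msubst (fun n => MBox (MVar n)) (GMT_unboxed phi).
Proof. by elim: phi => //= a -> b ->. Qed.

Lemma rhoE L phi : rho L phi = box_variant L (GMT_unboxed phi).
Proof. by rewrite /rho /box_variant /= GMT_unboxedE. Qed.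

(** The box variant and the superintuitionistic fragment of a logic determine
    each other. *)
Lemma box_variant_rho L S : NExt_S4 L -> NExt_S4 S ->
  box_variant L = box_variant S <-> rho L = rho S.
Proof.
move=> LS4 SS4; split=> LS; apply/seteqP; split=> a.
- by rewrite !rhoE LS.
- by rewrite !rhoE LS.
- by have [phi E] := box_variantE a; move/(E _ LS4); rewrite LS => /(E _ SS4).
- by have [phi E] := box_variantE a; move/(E _ SS4); rewrite -LS => /(E _ LS4).
Qed.

Lemma modal_companionP M L :
  modal_companion M (rho L) <-> NExt_S4 M /\ rho L = rho M.
Proof.
split=> [[MS4 _ LM]|[MS4 LM]].
  by split=> //; apply/seteqP; split=> phi /LM.
by split=> //; rewrite LM //; apply: Ext_IPC_rho.
Qed.

Theorem corollary6p8 :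
  (forall (d : Order.disp_t) (K : s4_class d), s4_variety K ->
     Log (sigma_class (rho_class K)) = Schem (box_variant (Log K))) /\
  (forall L : set mform, NExt_S4 L ->
     (box_maximal L <-> greatest_modal_companion L (rho L))).
Proof.
split=> [d K _|L LS4]; first exact: Log_sigma_rho.
split=> [maxL|[_ maxL] S SS4 LS].
  split; first exact/modal_companionP.
  by move=> M /modal_companionP[MS4 LM]; apply: maxL => //; apply/box_variant_rho.
by apply: maxL; apply/modal_companionP; split=> //; apply/box_variant_rho.
Qed.
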